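(* Let $k$ and $t$ be positive integers, let $I_k=[-k,k]=\{i\in\mathbb{Z}: -k\le i\le k\}$, and let $D(I_k)=\max\{2,2k-1\}$. (i) If $\mathsf{s}'_t(I_k)$ is finite, then every integer in $[1,D(I_k)]$ divides $t$. (ii) If every integer in $[1,D(I_k)]$ divides $t$, then \[t+k(k-1)\le \mathsf{s}'_t(I_k)\le t+(2k-2)(2k-3).\]
   Context: A sequence over a set $G_0\subseteq\mathbb{Z}$ is a finite unordered list of elements of $G_0$ with repetition allowed (a finite multiset). Its length $|S|$ is the number of terms counted with multiplicity, and its sum $\sigma(S)$ is the sum of its terms. A subsequence is a sub-multiset. $S$ is zero-sum if $\sigma(S)=0$. A zero-sum sequence is minimal if it is nonempty and contains no proper nonempty zero-sum subsequence. The Davenport constant $D(I_k)$ is the maximum length of a minimal zero-sum sequence over $I_k$; it is known (Lambert) that $D(I_k)=\max\{2,2k-1\}$. For a positive integer $t$, $\mathsf{s}'_t(I_k)$ is the smallest positive integer $\ell$ such that every zero-sum sequence $S$ over $I_k$ with $|S|\ge\ell$ contains a zero-sum subsequence of length $t$; if no such $\ell$ exists, $\mathsf{s}'_t(I_k)=\infty$. *)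

(* Defs.v *)
From mathcomp Require Import all_boot all_order all_algebra.
From mathcomp Require Import finmap multiset boolp.

Set Implicit Arguments.
Unset Strict Implicit.
Unset Printing Implicit Defensive.

Import Order.TTheory GRing.Theory Num.Theory.

Local Open Scope nat_scope.
Local Open Scope mset_scope.

Definition I_ (k : nat) : interval int := (`[- k%:Z, k%:Z])%R.

Definition seq_over (G0 : interval int) (S : {mset int}) : Prop :=
  {in S, forall x, x \in G0}.

(* A multiset coerces to the sequence listing its terms with multiplicity, so
   [size] and [\sum_(x <- S)] count multiplicities. *)
Definition sigma (S : {mset int}) : int := (\sum_(x <- S) x)%R.

Definition zero_sum (S : {mset int}) : Prop := sigma S = 0%R.

Definition forces_zero_sum (G0 : interval int) (t l : nat) : Prop :=
  forall S : {mset int}, seq_over G0 S -> zero_sum S -> l <= size S ->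
    exists T : {mset int}, [/\ T `<=` S, zero_sum T & size T = t].

(* [None] stands for infinity. *)
Definition s' (t : nat) (G0 : interval int) : option nat :=
  if pselect (exists l, `[< 0 < l /\ forces_zero_sum G0 t l >]) is left ex_l
  then Some (ex_minn ex_l) else None.

(* The value of the Davenport constant of [I_ k], by Lambert's theorem; for
   [k > 0] the truncated subtraction is exact. *)
Definition D_I (k : nat) : nat := maxn 2 (2 * k - 1).

(* Main.v *)
(** For (i), coprime [a, b <= k] give arbitrarily long zero-sum sequences over
    [{b, -a}], and the length of each of their zero-sum subsequences is a
    multiple of [a + b]; every [d] in [2, D_I k] is such a sum [a + b], or twice
    an odd one.

    For the lower bound, a zero-sum sequence of length [t + k ^ 2 - k - 1] over
    [{k, k - 1, -1}] has no zero-sum subsequence of length [t], as its complement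
    would have length [k ^ 2 - k - 1], the Frobenius number of [k] and [k + 1].

    For the upper bound, Lambert's argument (order the terms so that the partial
    sums stay in a short window) splits the sequence into zero-sum blocks of
    length at most [D = D_I k]. As [t >= D * (D - 1) * (D - 2)],
    some length [d] occurs at least [D - 1] times. Grouping the other blocks into
    groups of total length divisible by [d] leaves at most [d - 1] of them, and
    the blocks of length [d] then make up the difference to exactly [t]. *)

Require Import Defs.
From mathcomp Require Import all_boot all_order all_algebra.
From mathcomp Require Import finmap multiset boolp zify.

Set Implicit Arguments.
Unset Strict Implicit.
Unset Printing Implicit Defensive.

Import Order.TTheory GRing.Theory Num.Theory.

Local Open Scope nat_scope.

(** * Pigeonhole and cutting consecutive terms out of a list *)

Lemma pigeonhole (T : eqType) (f : nat -> T) (r : seq T) (n : nat) :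
  size r <= n -> (forall i, i <= n -> f i \in r) ->
  exists i j, i < j <= n /\ f i = f j.
Proof.
move=> le_r fr.
have : ~~ injectiveb (fun i : 'I_n.+1 => f i).
  apply/negP => /injectiveP inj_f.
  have uniq_f : uniq [seq f (nat_of_ord i) | i <- enum 'I_n.+1].
    by rewrite map_inj_uniq ?enum_uniq.
  have sub_f : {subset [seq f (nat_of_ord i) | i <- enum 'I_n.+1] <= r}.
    by move=> _ /mapP[i _ ->]; apply: fr; rewrite -ltnS.
  have := uniq_leq_size uniq_f sub_f.
  by rewrite size_map size_enum_ord leqNgt ltnS le_r.
case/injectivePn => i [j neq_ij eq_f].
move: neq_ij; rewrite -val_eqE neq_ltn => /orP[lt_ij | lt_ji].
- by exists i, j; rewrite lt_ij -ltnS ltn_ord.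
- by exists j, i; rewrite lt_ji -ltnS ltn_ord.
Qed.

Lemma perm_extract_block (T : eqType) (s : seq T) (i j : nat) : i <= j ->
  perm_eq s (take (j - i) (drop i s) ++ (take i s ++ drop j s)).
Proof.
move=> le_ij; rewrite perm_sym perm_catCA -{2}(subnK le_ij) -drop_drop.
by rewrite !cat_take_drop.
Qed.

Lemma take_extend (T : Type) (s : seq T) (i j : nat) : i <= j ->
  take j s = take i s ++ take (j - i) (drop i s).
Proof. by move=> le_ij; rewrite -takeD subnKC. Qed.

(** * Choosing terms of prescribed total weight *)

Section SubsetSums.

Variables (T : eqType) (w : T -> nat).

(** Among the prefix sums of lengths 0 to [d], two agree modulo [d]; [u] is the block between
    them. *)
Lemma extract_dvdn (d : nat) (s : seq T) : 0 < d -> d <= size s ->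
  exists u v, [/\ perm_eq s (u ++ v), 0 < size u <= d
                & d %| \sum_(x <- u) w x].
Proof.
move=> d_gt0 le_ds.
have [i [j [/andP[lt_ij le_jd] eq_ij]]] := @pigeonhole _
  (fun i => (\sum_(x <- take i s) w x) %% d) (iota 0 d) d
  ltac:(by rewrite size_iota) ltac:(by move=> i _; rewrite mem_iota ltn_mod).
exists (take (j - i) (drop i s)), (take i s ++ drop j s); split.
- exact/perm_extract_block/ltnW.
- have le_block : j - i <= size (drop i s) by rewrite size_drop; lia.
  by rewrite size_takel //; lia.
move/eqP: eq_ij; rewrite /= (take_extend s (ltnW lt_ij)) big_cat /=.
by rewrite -[X in X == _ %[mod d]]addn0 eqn_modDl mod0n eq_sym.
Qed.

(* While [n] copies of [d] do not reach [t], we have [M * d <= t], so a block of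
   at most [d] terms with sum divisible by [d] still fits below [t]. *)
Lemma subset_sum_fill (d M n t : nat) (s : seq T) :
  0 < d -> {in s, forall x, w x <= M} -> M <= n.+1 -> d %| t ->
  t + (d - 1) * M < \sum_(x <- s) w x + n * d + d ->
  exists u v j, [/\ perm_eq s (u ++ v), j <= n
                  & \sum_(x <- u) w x + j * d = t].
Proof.
move=> d_gt0.
have [m] := ubnP (size s); elim: m => // m IHm in s t *.
rewrite ltnS => le_sm ws le_Mn d_t lt_t.
have [le_tn | lt_nt] := leqP t (n * d).
  exists [::], s, (t %/ d); split=> //; last by rewrite big_nil divnK.
  by rewrite leq_divLR.
have le_Mt : M * d <= t.
  case/dvdnP: d_t lt_nt => q ->; rewrite ltn_pmul2r // => lt_nq.
  by rewrite leq_pmul2r // (leq_trans le_Mn).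
have sum_le (r : seq T) : {subset r <= s} -> \sum_(x <- r) w x <= size r * M.
  move=> sub_rs; rewrite -sum1_size big_distrl /= big_seq [leqRHS]big_seq.
  by apply: leq_sum => x /sub_rs /ws; rewrite mul1n.
have [le_ds | lt_sd] := leqP d (size s).
  have [u [v [s_uv /andP[u_gt0 le_ud] d_u]]] := extract_dvdn d_gt0 le_ds.
  have sub_u : {subset u <= s}.
    by move=> x xu; rewrite (perm_mem s_uv) mem_cat xu.
  have sub_v : {subset v <= s}.
    by move=> x xv; rewrite (perm_mem s_uv) mem_cat xv orbT.
  have le_ut : \sum_(x <- u) w x <= t.
    apply: leq_trans (sum_le _ sub_u) (leq_trans _ le_Mt).
    by rewrite mulnC leq_mul2l le_ud orbT.
  have sum_s : \sum_(x <- s) w x = \sum_(x <- u) w x + \sum_(x <- v) w x.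
    by rewrite (perm_big _ s_uv) big_cat.
  have size_s := perm_size s_uv; rewrite size_cat in size_s.
  have [| | | | | u' [v' [j [v_uv' le_jn sum_u']]]] :=
    IHm v (t - \sum_(x <- u) w x).
  - by lia.
  - by move=> x /sub_v /ws.
  - by [].
  - by rewrite dvdn_subr.
  - by lia.
  exists (u ++ u'), v', j; split=> //; last by rewrite big_cat /=; lia.
  by rewrite (perm_trans s_uv) // -catA perm_cat2l.
(* With fewer than [d] terms left, the hypothesis gives [t < n.+1 * d]; but [t] is a multiple of [d]
   exceeding [n * d]. *)
have le_sum : \sum_(x <- s) w x <= (d - 1) * M.
  apply: leq_trans (sum_le s _) _ => //.
  by rewrite leq_mul2r; apply/orP; right; lia.
case/dvdnP: d_t lt_nt lt_t => q ->; rewrite ltn_pmul2r // => lt_nq lt_t.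
have : n.+1 * d <= q * d by rewrite leq_pmul2r.
by rewrite mulSn; lia.
Qed.

Lemma sum_split_weight (d : nat) (s : seq T) :
  \sum_(x <- s) w x =
    \sum_(x <- s | w x != d) w x + count (fun x => w x == d) s * d.
Proof.
rewrite (bigID (fun x => w x == d)) /= addnC; congr addn.
rewrite -sum1_count big_distrl /=.
by apply: eq_bigr => x /eqP ->; rewrite mul1n.
Qed.

(** Each weight [d] contributes at most [c * d], and these bounds add up to
    [c * D * (D + 1) / 2]. *)
Lemma sum_le_counts (D c : nat) (s : seq T) :
  {in s, forall x, w x <= D} ->
  (forall d, 0 < d <= D -> count (fun x => w x == d) s <= c) ->
  2 * \sum_(x <- s) w x <= c * (D * D.+1).
Proof.
elim: D s => [|D IHD] s ws cs.
  rewrite big_seq big1 ?muln0 // => x xs.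
  by apply/eqP; rewrite -leqn0 ws.
rewrite (sum_split_weight D.+1 s) -big_filter.
have := IHD [seq x <- s | w x != D.+1].
have := cs D.+1; rewrite leqnn => /(_ isT) le_c.
have le_cD : count (fun x => w x == D.+1) s * D.+1 <= c * D.+1.
  by rewrite leq_mul2r le_c orbT.
set S := \sum_(x <- _) _ => IH.
have : 2 * S <= c * (D * D.+1).
  apply: IH.
    move=> x; rewrite mem_filter => /andP[neq_x /ws].
    by rewrite leq_eqVlt (negPf neq_x).
  move=> d /andP[d_gt0 le_dD].
  apply: leq_trans (cs d _); last by rewrite d_gt0 ltnW.
  by rewrite count_filter; apply: sub_count => x /= /andP[].
by nia.
Qed.

(* Either some [d] occurs [D - 1] times as a weight, or the total weight is at
   most [(D - 2) * D * (D + 1) / 2], too small by the bound on [t]. *)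
Lemma subset_sum (D t : nat) (s : seq T) :
  1 < D -> {in s, forall x, 0 < w x <= D} ->
  (forall d, 0 < d <= D -> d %| t) ->
  D * (D - 1) * (D - 2) <= t -> 0 < t ->
  t + (D - 1) * (D - 2) <= \sum_(x <- s) w x ->
  exists u v, perm_eq s (u ++ v) /\ \sum_(x <- u) w x = t.
Proof.
move=> D_gt1 ws dvd_t le_t t_gt0 le_s.
have [[d /andP[d_gt0 le_dD] le_c] | no_d] :=
  pselect (exists2 d, 0 < d <= D & D - 1 <= count (fun x => w x == d) s).
  set n := count (fun x => w x == d) s in le_c.
  (* [M] bounds the weights other than [d]. For [d = D] the sharper value matters:
     [(d - 1) * M < (D - 1) * (D - 2) + d] would fail with [M = D]. *)
  pose M := if d == D then D - 1 else D.
  have [||||u [v [j [s_uv le_jn sum_u]]]] :=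
    @subset_sum_fill d M n t [seq x <- s | w x != d] d_gt0.
  - move=> x; rewrite mem_filter /M => /andP[neq_x /ws /andP[_ le_x]].
    by case: eqP => // eq_dD; move: neq_x; rewrite eq_dD; lia.
  - by rewrite /M; case: eqP; lia.
  - by apply: dvd_t; rewrite d_gt0.
  - rewrite big_filter; rewrite (sum_split_weight d) -/n in le_s.
    rewrite /M; case: eqP => [eq_d | neq_d]; first by subst d; nia.
    have : d <= D - 1 by lia.
    by nia.
  set cd := [seq x <- s | w x == d].
  exists (u ++ take j cd), (v ++ drop j cd); split.
    rewrite -(perm_filterC (fun x => w x == d)) perm_catC -[X in perm_eq _ X]catA.
    rewrite (@perm_trans _ ((u ++ v) ++ cd)) ?perm_cat2r //.
    rewrite -catA perm_cat2l perm_sym perm_catCA perm_cat2l.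
    by rewrite cat_take_drop.
  rewrite big_cat /= -sum_u; congr addn.
  rewrite big_seq (eq_bigr (fun=> d)); last first.
    by move=> x /mem_take; rewrite mem_filter => /andP[/eqP].
  rewrite -big_seq big_const_seq count_predT iter_addn_0 size_takel 1?mulnC //.
  by rewrite size_filter.
have le_sum : 2 * \sum_(x <- s) w x <= (D - 2) * (D * D.+1).
  apply: sum_le_counts => [x /ws /andP[] // | d Dd].
  have [le_c|] := leqP (D - 1) (count (fun x => w x == d) s); last by lia.
  by case: no_d; exists d.
(* The total weight is at least [(D - 2) * (D - 1) * (D + 1)], which exceeds the bound [le_sum] once
   [D > 2]. For [D = 2] the bound is 0, against [t > 0]. *)
exfalso; have [eq_D | neq_D] := eqVneq D 2; first by subst D; nia.
have [D' eq_D] : exists D', D = D'.+3 by exists (D - 3); lia.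
by subst D; nia.
Qed.

End SubsetSums.

(** * Lambert's argument: splitting into short zero-sum blocks *)

Section Lambert.

Local Open Scope ring_scope.

(** Greedy choice: take a positive term when the running sum [p] is at most 0, a negative one
    otherwise. Such a term exists because the remaining terms sum to [- p] and are nonzero. *)
Lemma balanced_order (a b : nat) (p : int) (s : seq int) :
  {in s, forall x : int, [&& x != 0, - b%:Z <= x & x <= a%:Z]} ->
  p + \sum_(x <- s) x = 0 -> - b%:Z < p <= a%:Z ->
  exists2 r : seq int, perm_eq s r
    & forall i, - b%:Z < p + \sum_(x <- take i r) x <= a%:Z.
Proof.
have [m] := ubnP (size s); elim: m => // m IHm in s p *.
rewrite ltnS => le_sm s_ab sum_s p_ab.
have [s0 | s_neq0] := eqVneq s [::].
  by exists [::] => [|i]; rewrite ?s0 // big_nil addr0.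
have [x xs px_ab] : exists2 x, x \in s & - b%:Z < p + x <= a%:Z.
  have [le_p0 | lt_0p] := lerP p 0.
    have /hasP[x xs x_gt0] : has (fun x => 0 < x) s.
      apply: contraT => /hasPn s_le0.
      have : \sum_(x <- s) x < 0.
        case: s s_neq0 s_ab s_le0 {le_sm sum_s} => // y s _ s_ab s_le0.
        rewrite big_cons /=.
        have y_lt0 : y < 0.
          have := s_ab y (mem_head _ _); have /= := s_le0 y (mem_head _ _).
          by lia.
        have : \sum_(x <- s) x <= 0.
          rewrite big_seq; apply: sumr_le0 => z zs.
          by have := s_le0 z; rewrite inE zs orbT => /(_ isT) /=; lia.
        by move=> le_s; rewrite -[ltRHS]addr0 ltr_leD.
      by move: sum_s; set S := \sum_(x <- s) x; lia.
    by exists x => //; have := s_ab x xs; lia.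
  have /hasP[x xs x_lt0] : has (fun x => x < 0) s.
    apply: contraT => /hasPn s_ge0.
    have : 0 <= \sum_(x <- s) x.
      by rewrite big_seq; apply: sumr_ge0 => z /s_ge0 /=; lia.
    by move: sum_s; set S := \sum_(x <- s) x; lia.
  by exists x => //; have := s_ab x xs; lia.
have s_rem := perm_to_rem xs.
have [|||r rem_r r_ab] := IHm (rem x s) (p + x) _ _ _ px_ab.
- by have := perm_size s_rem; rewrite /= => <-.
- by move=> y /mem_rem /s_ab.
- by move: sum_s; rewrite (perm_big _ s_rem) big_cons addrA.
exists (x :: r) => [|[|i]]; first by rewrite (perm_trans s_rem) // perm_cons.
- by rewrite take0 big_nil addr0.
- by rewrite /= big_cons addrA.
Qed.

(* The partial sums of the balanced order take at most [a + b] values, so two of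
   any [a + b + 1] consecutive ones coincide. *)
Lemma extract_zero_sum_window (a b : nat) (s : seq int) :
  (0 < b)%N -> {in s, forall x : int, [&& x != 0, - b%:Z <= x & x <= a%:Z]} ->
  \sum_(x <- s) x = 0 -> s != [::] ->
  exists u v : seq int, [/\ perm_eq s (u ++ v), (0 < size u <= a + b)%N
                & \sum_(x <- u) x = 0].
Proof.
move=> b_gt0 s_ab sum_s s_neq0.
have [le_s | lt_s] := leqP (size s) (a + b).
  by exists s, [::]; rewrite cats0 le_s lt0n size_eq0 s_neq0; split.
have [||r s_r r_ab] := balanced_order s_ab (p := 0); rewrite ?add0r //.
  by lia.
have r_window i : (i <= a + b)%N ->
    \sum_(x <- take i r) x \in [seq h%:Z - (b - 1)%:Z | h <- iota 0 (a + b)].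
  move=> _; have := r_ab i; rewrite add0r; move: (\sum_(x <- _) x) => p p_ab.
  by apply/mapP; exists (absz (p + (b - 1)%:Z)); rewrite ?mem_iota; lia.
have [|i [j [/andP[lt_ij le_j] eq_ij]]] := pigeonhole _ r_window.
  by rewrite size_map size_iota.
exists (take (j - i) (drop i r)), (take i r ++ drop j r); split.
- exact/(perm_trans s_r)/perm_extract_block/ltnW.
- have le_block : (j - i <= size (drop i r))%N.
    by rewrite size_drop -(perm_size s_r) leq_sub2r // (leq_trans le_j) // ltnW.
  by rewrite size_takel //; lia.
move/esym/eqP: eq_ij; rewrite (take_extend r (ltnW lt_ij)) big_cat /=.
by rewrite -subr_eq0 addrAC subrr add0r => /eqP.
Qed.

(** A term 0, or for [k > 1] a pair [k], [-k], is itself a block. Otherwise one endpoint is missing,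
    and the shorter window has [a + b = 2 * k - 1]. For [k = 1] the full window has [a + b = 2]. *)
Lemma extract_zero_sum (k : nat) (s : seq int) :
  (0 < k)%N -> {in s, forall x, - k%:Z <= x <= k%:Z} ->
  \sum_(x <- s) x = 0 -> s != [::] ->
  exists u v : seq int, [/\ perm_eq s (u ++ v), (0 < size u <= D_I k)%N
                & \sum_(x <- u) x = 0].
Proof.
move=> k_gt0 s_k sum_s s_neq0; rewrite /D_I.
have [s_0 | s_n0] := boolP (0 \in s).
  exists [:: 0], (rem 0 s); rewrite big_seq1; split=> //.
    exact: perm_to_rem.
  by rewrite /=; lia.
have s_neq : {in s, forall x, x != 0} by move=> x; apply: contraTneq => ->.
have window (a b : nat) : (0 < b)%N -> (a + b <= maxn 2 (2 * k - 1))%N ->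
    {in s, forall x, - b%:Z <= x <= a%:Z} ->
    exists u v : seq int, [/\ perm_eq s (u ++ v), (0 < size u <= maxn 2 (2 * k - 1))%N
                  & \sum_(x <- u) x = 0].
  move=> b_gt0 le_ab s_ab.
  have [|u [v [s_uv /andP[u_gt0 le_u] sum_u]]] :=
    extract_zero_sum_window (a := a) b_gt0 _ sum_s s_neq0.
    by move=> x xs; rewrite s_neq // s_ab.
  by exists u, v; rewrite u_gt0 (leq_trans le_u).
have [k1 | k_gt1] := leqP k 1.
  by apply: (window k k) => //; lia.
have [s_mk | s_nmk] := boolP (- k%:Z \in s); last first.
  apply: (window k (k - 1)%N); try lia.
  move=> x xs; have := s_k x xs.
  have : x != - k%:Z by apply: contraTneq xs => ->.
  by lia.
have [s_pk | s_npk] := boolP (k%:Z \in s); last first.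
  apply: (window (k - 1)%N k); try lia.
  move=> x xs; have := s_k x xs.
  have : x != k%:Z by apply: contraTneq xs => ->.
  by lia.
exists [:: k%:Z; - k%:Z], (rem (- k%:Z) (rem k%:Z s)); split.
- rewrite (perm_trans (perm_to_rem s_pk)) //= perm_cons.
  apply: perm_to_rem; have := perm_mem (perm_to_rem s_pk) (- k%:Z).
  by rewrite s_mk inE => /esym /orP[/eqP|//]; lia.
- by rewrite /=; lia.
- by rewrite big_cons big_seq1 subrr.
Qed.

Lemma zero_sum_factorization (k : nat) (s : seq int) :
  (0 < k)%N -> {in s, forall x, - k%:Z <= x <= k%:Z} -> \sum_(x <- s) x = 0 ->
  exists2 ss : seq (seq int), perm_eq s (flatten ss)
    & {in ss, forall u, \sum_(x <- u) x = 0 /\ (0 < size u <= D_I k)%N}.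
Proof.
move=> k_gt0.
have [m] := ubnP (size s); elim: m => // m IHm in s *.
rewrite ltnS => le_sm s_k sum_s.
have [-> | s_neq0] := eqVneq s [::]; first by exists [::].
have [u [v [s_uv u_D sum_u]]] := extract_zero_sum k_gt0 s_k sum_s s_neq0.
have size_s : size s = (size u + size v)%N by rewrite (perm_size s_uv) size_cat.
have [|||ss v_ss ss_D] := IHm v.
- by lia.
- by move=> x xv; apply: s_k; rewrite (perm_mem s_uv) mem_cat xv orbT.
- by move: sum_s; rewrite (perm_big _ s_uv) big_cat /= sum_u add0r.
exists (u :: ss); first by rewrite (perm_trans s_uv) //= perm_cat2l.
by move=> x; rewrite inE => /predU1P[-> | /ss_D].
Qed.

End Lambert.

(** * Passing between multisets and lists *)

Local Open Scope mset_scope.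

Lemma seq_overP (k : nat) (S : {mset int}) :
  seq_over (I_ k) S <-> {in S, forall x, - k%:Z <= x <= k%:Z}%R.
Proof. by split=> S_k x /S_k; rewrite in_itv. Qed.

Lemma msubset_perm (K : choiceType) (S : {mset K}) (u v : seq K) :
  perm_eq S (u ++ v) -> seq_mset u `<=` S.
Proof.
move=> /permP S_uv; apply/msubsetP => x.
by rewrite mset_seqE -count_mem_mset S_uv count_cat leq_addr.
Qed.

Lemma perm_msetD (K : choiceType) (A B : {mset K}) : perm_eq (A `+` B) (A ++ B).
Proof.
have -> : A `+` B = seq_mset (A ++ B).
  by apply/msetP => x; rewrite mset_seqE count_cat !count_mem_mset msetE2.
exact: perm_eq_seq_mset.
Qed.

Lemma sigma_seq_mset (s : seq int) : sigma (seq_mset s) = (\sum_(x <- s) x)%R.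
Proof. exact/perm_big/perm_eq_seq_mset. Qed.

Lemma size_seq_mset (K : choiceType) (s : seq K) : size (seq_mset s) = size s.
Proof. exact/perm_size/perm_eq_seq_mset. Qed.

(** * Sequences with two or three values: part (i) and the lower bound *)

Lemma sum_nseq (n : nat) (x : int) : (\sum_(y <- nseq n x) y)%R = (x * n%:Z)%R.
Proof. by rewrite big_nseq iter_addr_0 -mulr_natr natz. Qed.

Lemma two_valued_sum (a b : int) (s : seq int) : {subset s <= [:: a; b]} ->
  exists x y : nat, size s = x + y /\ (\sum_(z <- s) z = a * x%:Z + b * y%:Z)%R.
Proof.
elim: s => [_|z s IHs sub]; first by exists 0, 0; rewrite big_nil !mulr0.
have [z' s_z'|x [y [sz sum]]] := IHs; first by apply: sub; rewrite inE s_z' orbT.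
rewrite big_cons /= sz sum.
have := sub z (mem_head _ _); rewrite !inE => /orP[] /eqP ->.
- by exists x.+1, y; split; nia.
- by exists x, y.+1; split; nia.
Qed.

Lemma three_valued_sum (a b c : int) (s : seq int) : {subset s <= [:: a; b; c]} ->
  exists x y z : nat, size s = x + y + z /\
    (\sum_(r <- s) r = a * x%:Z + b * y%:Z + c * z%:Z)%R.
Proof.
elim: s => [_|r s IHs sub]; first by exists 0, 0, 0; rewrite big_nil !mulr0.
have [r' s_r'|x [y [z [sz sum]]]] := IHs;
  first by apply: sub; rewrite inE s_r' orbT.
rewrite big_cons /= sz sum.
have := sub r (mem_head _ _); rewrite !inE => /or3P[] /eqP ->.
- by exists x.+1, y, z; split; nia.
- by exists x, y.+1, z; split; nia.
- by exists x, y, z.+1; split; nia.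
Qed.

(* Every zero-sum sequence over [{b, -a}] consists of [a * j] copies of [b] and
   [b * j] copies of [-a]. *)
Lemma forces_zero_sum_dvdn (k t l a b : nat) :
  forces_zero_sum (I_ k) t l -> 0 < a <= k -> 0 < b <= k -> coprime a b ->
  a + b %| t.
Proof.
move=> force a_k b_k cop_ab.
pose s := nseq (l * a) b%:Z%R ++ nseq (l * b) (- a%:Z)%R.
have sub_s : {subset s <= [:: b%:Z; - a%:Z]%R}.
  by move=> x; rewrite mem_cat !mem_nseq !inE => /orP[] /andP[_ ->]; rewrite ?orbT.
have mem_S : seq_mset s =i s by exact/perm_mem/perm_eq_seq_mset.
have [|||T [sub_T sum_T size_T]] := force (seq_mset s).
- apply/seq_overP => x; rewrite mem_S => /sub_s.
  by rewrite !inE => /orP[] /eqP ->; lia.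
- by rewrite /zero_sum sigma_seq_mset big_cat /= !sum_nseq; nia.
- by rewrite size_seq_mset size_cat !size_nseq; nia.
have [x /(msubset_subset sub_T)|x [y [size_xy sum_xy]]] :=
  @two_valued_sum b%:Z%R (- a%:Z)%R T; first by rewrite mem_S => /sub_s.
move: sum_T; rewrite /zero_sum /sigma sum_xy => eq_xy.
have eq_xy' : b * x = a * y by nia.
have /dvdnP[j eq_x] : a %| x by rewrite -(Gauss_dvdr x cop_ab) eq_xy' dvdn_mulr.
have eq_y : y = b * j by nia.
by apply/dvdnP; exists j; rewrite -size_T size_xy eq_x eq_y; lia.
Qed.

Lemma forces_zero_sum_all_dvdn (k t l : nat) : 0 < k ->
  forces_zero_sum (I_ k) t l -> forall d, 0 < d <= D_I k -> d %| t.
Proof.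
rewrite /D_I => k_gt0 force.
have t_even : 2 %| t by apply: (@forces_zero_sum_dvdn k t l 1 1).
have odd_dvd m : m < k -> 2 * m + 1 %| t.
  case: m => [|m] lt_mk; first by rewrite dvd1n.
  have -> : 2 * m.+1 + 1 = m.+1 + m.+2 by lia.
  by apply: (@forces_zero_sum_dvdn k t l); rewrite ?coprimenS //; lia.
move=> d d_D; have [odd_d | even_d] := boolP (odd d).
  have -> : d = 2 * d./2 + 1 by have := odd_double_half d; lia.
  by apply: odd_dvd; have := odd_double_half d; lia.
have eq_d : d = 2 * d./2 by have := odd_double_half d; lia.
move: eq_d; set m := d./2 => eq_d.
(* For odd [m], the coprime factors 2 and [m] of [d] both divide [t]. *)
have [odd_m | even_m] := boolP (odd m).
  rewrite eq_d Gauss_dvd ?coprime2n // t_even /=.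
  have -> : m = 2 * m./2 + 1 by have := odd_double_half m; lia.
  by apply: odd_dvd; have := odd_double_half m; lia.
(* For even [m], the numbers [m - 1] and [m + 1] are odd and differ by 2, hence coprime. *)
have -> : d = (m - 1) + (m + 1) by lia.
apply: (@forces_zero_sum_dvdn k t l) => //; try by have := odd_double_half m; lia.
have -> : m + 1 = 2 + (m - 1) by have := odd_double_half m; lia.
rewrite /coprime gcdnDr -/(coprime _ 2) coprimen2.
by have := odd_double_half m; lia.
Qed.

(* Zero-sum sequences over [{k, k - 1, -1}] have lengths [x * (k + 1) + y * k],
   which misses the Frobenius number [k ^ 2 - k - 1] of [k] and [k + 1]. *)
Lemma forces_zero_sum_lower (k t l : nat) : 0 < k -> 0 < t -> k %| t ->
  forces_zero_sum (I_ k) t l -> t + k * (k - 1) <= l.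
Proof.
move=> k_gt0 t_gt0 /dvdnP[m eq_t] force; rewrite leqNgt; apply/negP => lt_l.
have m_gt0 : 0 < m by nia.
(* [z] copies of -1 cancel the positive terms. As [t = m * k], the length is [(k - 1) * (k + 1) + (m
   - 1) * k = t + k ^ 2 - k - 1]. *)
pose z := (k - 1) * k + (m - 1) * (k - 1).
pose s := nseq (k - 1) k%:Z%R ++ nseq (m - 1) (k%:Z - 1)%R ++ nseq z (-1)%R.
have sub_s : {subset s <= [:: k%:Z; k%:Z - 1; -1]%R}.
  move=> x; rewrite !mem_cat !mem_nseq !inE.
  by move=> /or3P[] /andP[_ ->]; rewrite ?orbT.
have size_s : size s + k + 1 = t + k * k.
  by rewrite !size_cat !size_nseq /z; nia.
have le_ls : l <= size s by nia.
have mem_S : seq_mset s =i s by exact/perm_mem/perm_eq_seq_mset.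
have sum_s : zero_sum (seq_mset s).
  by rewrite /zero_sum sigma_seq_mset !big_cat /= !sum_nseq /z; nia.
have [|//||T [sub_T sum_T size_T]] := force (seq_mset s).
- apply/seq_overP => x; rewrite mem_S => /sub_s.
  by rewrite !inE => /or3P[] /eqP ->; lia.
- by rewrite size_seq_mset.
set R := seq_mset s `\` T.
have S_TR : perm_eq (seq_mset s) (T ++ R).
  by rewrite -(msetBDKC sub_T) perm_msetD.
have [x xR|x [y [z' [size_R sum_R]]]] :=
  @three_valued_sum k%:Z%R (k%:Z - 1)%R (-1)%R R.
  by apply: sub_s; rewrite -mem_S (perm_mem S_TR) mem_cat xR orbT.
have size_eq : size s = t + (x + y + z').
  by rewrite -size_T -size_R -size_cat -(perm_size S_TR) size_seq_mset.
move: sum_s; rewrite /zero_sum /sigma (perm_big _ S_TR) big_cat /=.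
rewrite [X in (X + _)%R]sum_T add0r sum_R => sum_eq.
(* The complement [R] has length [x * (k + 1) + y * k = k ^ 2 - k - 1]; adding [k + 1] gives this
   equation. It forces [k] to divide [x + 1], so the left side is at least [k * (k + 1)], too
   large. *)
have eq_k : x.+1 * k.+1 + y * k = k * k by nia.
have : k %| x.+1 * k.+1.
  by rewrite -(dvdn_addl _ (dvdn_mull y (dvdnn k))) eq_k dvdn_mulr.
rewrite Gauss_dvdl ?coprimenS // => /dvdn_leq /= le_kx.
by have := le_kx isT; nia.
Qed.

(** * The upper bound *)

(** For [k > 1], [D_I k] is odd, so the three factors are pairwise coprime divisors of [t]. For
    [k = 1] the product is 0. *)
Lemma D_I_cube_le (k t : nat) : 0 < k -> 0 < t ->
  (forall d, 0 < d <= D_I k -> d %| t) ->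
  D_I k * (D_I k - 1) * (D_I k - 2) <= t.
Proof.
move=> k_gt0 t_gt0 dvd_t.
have [k1 | k_gt1] := leqP k 1.
  by have -> : D_I k = 2 by rewrite /D_I; lia.
have [m eq_D] : exists m, D_I k = m.*2.+3.
  by exists (k - 2); rewrite /D_I; lia.
rewrite eq_D in dvd_t *; rewrite subSS subn0 subSS subSS subn0.
apply: dvdn_leq => //.
have cop1 : coprime m.*2.+3 m.*2.+2 by rewrite coprimeSn.
have cop2 : coprime m.*2.+2 m.*2.+1 by rewrite coprimeSn.
have cop3 : coprime m.*2.+3 m.*2.+1.
  by rewrite -[m.*2.+3]/(2 + m.*2.+1) coprime_sym /coprime gcdnDr
    -/(coprime _ 2) coprimen2 /= odd_double.
by rewrite !Gauss_dvd ?coprimeMl ?cop3 // !dvd_t //; lia.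
Qed.

Lemma forces_zero_sum_upper (k t : nat) : 0 < k -> 0 < t ->
  (forall d, 0 < d <= D_I k -> d %| t) ->
  forces_zero_sum (I_ k) t (t + (2 * k - 2) * (2 * k - 3)).
Proof.
move=> k_gt0 t_gt0 dvd_t S /seq_overP S_k sum_S le_S.
have [ss S_ss ss_D] := zero_sum_factorization k_gt0 S_k sum_S.
have [|||||us [vs [ss_uv sum_us]]] := @subset_sum _ size (D_I k) t ss _ _ dvd_t.
- by rewrite /D_I; lia.
- by move=> u /ss_D[].
- exact: D_I_cube_le.
- by [].
- have -> : \sum_(u <- ss) size u = size S.
    by rewrite (perm_size S_ss) size_flatten sumnE big_map.
  apply: leq_trans le_S; rewrite leq_add2l /D_I.
  (* For [k = 1] both products vanish, [2 * k - 3] being truncated to 0; otherwise they are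
     equal. *)
  have [k1 | k_gt1] := leqP k 1; first by have -> : k = 1 by lia.
  have -> : maxn 2 (2 * k - 1) = 2 * k - 1 by lia.
  by rewrite -!subnDA leqnn.
exists (seq_mset (flatten us)); split.
- apply: (@msubset_perm _ _ _ (flatten vs)).
  by rewrite (perm_trans S_ss) // -flatten_cat perm_flatten.
- rewrite /zero_sum sigma_seq_mset big_flatten /= big_seq big1 // => u u_us.
  by apply: (ss_D u _).1; rewrite (perm_mem ss_uv) mem_cat u_us.
- by rewrite size_seq_mset size_flatten sumnE big_map.
Qed.

(** * From forcing lengths to the value of [s'] *)

Lemma s'_SomeP (t : nat) (G0 : interval int) (l : nat) : s' t G0 = Some l ->
  forces_zero_sum G0 t l.
Proof.
by rewrite /s'; case: pselect => // ex_l [<-]; case: ex_minnP => n /asboolP[].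
Qed.

Lemma s'_le (t : nat) (G0 : interval int) (l : nat) : 0 < l ->
  forces_zero_sum G0 t l -> exists2 n, s' t G0 = Some n & n <= l.
Proof.
move=> l_gt0 force; rewrite /s'; case: pselect => [ex_l | []]; last first.
  by exists l; apply/asboolP.
by exists (ex_minn ex_l) => //; case: ex_minnP => n _; apply; apply/asboolP.
Qed.

Theorem theorem1 (k t : nat) (k_gt0 : 0 < k) (t_gt0 : 0 < t) :
  ((exists l : nat, s' t (I_ k) = Some l) ->
     forall d : nat, 1 <= d <= D_I k -> d %| t)
  /\
  ((forall d : nat, 1 <= d <= D_I k -> d %| t) ->
     exists2 l : nat, s' t (I_ k) = Some l &
       t + k * (k - 1) <= l <= t + (2 * k - 2) * (2 * k - 3)).
Proof.
split=> [[l /s'_SomeP force] | dvd_t].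
  exact: forces_zero_sum_all_dvdn force.
have [|l s'_l le_l] := s'_le _ (forces_zero_sum_upper k_gt0 t_gt0 dvd_t).
  by rewrite addn_gt0 t_gt0.
exists l => //; rewrite le_l andbT.
apply: forces_zero_sum_lower (s'_SomeP s'_l) => //.
by apply: dvd_t; rewrite /D_I; lia.
Qed.
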